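(* Let $V$ be a lightlike hypersurface of an $n$-dimensional pseudo-Riemannian manifold $(M,g)$ of Lorentzian signature. Then any isotropic geodesic $l$ of $V$ carries $n-2$ real singular points if each of them is counted as many times as its multiplicity (a singular point being allowed to be the point at infinity of $l$).
   Context: $(M,g)$ has signature $(n-1,1)$, with Levi-Civita connection $D$. A lightlike hypersurface $V$ is a hypersurface ($\dim V=n-1$) on which $g$ has rank $n-2$, i.e. each $T_xV$ is tangent to the isotropic cone $\{\xi: g(\xi,\xi)=0\}$. A first-order isotropic frame at $x\in V$ is a basis $(e_1,\dots,e_n)$ of $T_xM$ with $e_1$ isotropic and $T_xV=\mathrm{span}(e_1,e_2,\dots,e_{n-1})$, $e_a$ ($a=2,\dots,n-1$) spacelike and orthogonal to $e_1$, $g_{ab}=(e_a,e_b)$ positive definite, $e_n$ isotropic, $(e_1,e_n)=-1$, $(e_a,e_n)=0$. Write $dx=\omega^ie_i$, $De_i=\omega_i^je_j$. On $V$ one has $\omega^n=0$ and $\omega_a^n=\lambda_{ab}\omega^b$ with $\lambda_{ab}=\lambda_{ba}$ (second fundamental tensor), and $\omega_1^a=\lambda^a_b\omega^b$ with $\lambda^a_b=g^{ac}\lambda_{cb}$. The integral curves of the isotropic direction field $e_1$ on $V$ are the isotropic geodesics of $V$. Singular points. Under the development of $(M,g)$ onto the tangent pseudo-Euclidean space $T_xM$, the isotropic geodesic through $x\in V$ in direction $e_1$ corresponds to the straight line $l=\{y=x+se_1\}$, and the formal differential of $y$ is $dy=(ds+s\omega_1^1+\omega^1)e_1+(\delta^a_b+s\lambda^a_b)\omega^be_a$.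 The point $y=x+se_1$ of $l$ is singular if the Jacobian $J(s)=\det(\delta^a_b+s\lambda^a_b)_{a,b=2,\dots,n-1}$ vanishes. Multiplicities are those of the eigenvalues of $(\lambda^a_b)$, a nonzero eigenvalue $\lambda_a$ corresponding to the singular point with $s=-1/\lambda_a$ and a zero eigenvalue corresponding to the point at infinity of $l$; equivalently, singular points are the zeros $(t:s)$ of the degree $n-2$ form $\det(t\,\delta^a_b+s\lambda^a_b)$. *)

(* Defs.v *)
From HB Require Import structures.
From mathcomp Require Export all_boot all_order all_algebra.
From mathcomp Require Export all_classical all_reals all_analysis.
Export Order.TTheory GRing.Theory Num.Theory.
Export numFieldNormedType.Exports.

Set Implicit Arguments.
Unset Strict Implicit.
Unset Printing Implicit Defensive.

Global Open Scope classical_set_scope.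
Global Open Scope ring_scope.

(* Vectors are row vectors; the Jacobian 'J F u therefore acts on the right,
   dF_u(w) = w *m 'J F u, and the rows of 'J F u span the image of dF_u.      *)

Fixpoint Ck (R : realType) (U W : normedModType R) (k : nat) (A : set U)
    (f : U -> W) : Prop :=
  if k is k'.+1 then
    (forall x, A x -> differentiable f x) /\ (forall v, Ck k' A ('D_v f))
  else forall x, A x -> {for x, continuous f}.

(* Used for open A only, so that the values of f off A are irrelevant. *)
Definition smooth_on (R : realType) (U W : normedModType R) (A : set U)
    (f : U -> W) : Prop := forall k, Ck k A f.

Record chart (R : realType) (n : nat) (M : topologicalType) := Chart {
  dom : set M;
  coord : M -> 'rV[R]_n;
  point : 'rV[R]_n -> M;
  dom_open : open dom;
  img_open : open (coord @` dom);
  coordK : forall x, dom x -> point (coord x) = x;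
  coord_continuous : forall x, dom x -> {for x, continuous coord};
  point_continuous : forall u, (coord @` dom) u -> {for u, continuous point}
}.

Definition local_dom (R : realType) (n n' : nat) (M N : topologicalType)
    (f : M -> N) (c : chart R n M) (c' : chart R n' N) : set 'rV[R]_n :=
  coord c @` (dom c `&` f @^-1` dom c').

Definition local_map (R : realType) (n n' : nat) (M N : topologicalType)
    (f : M -> N) (c : chart R n M) (c' : chart R n' N) :
    'rV[R]_n -> 'rV[R]_n' :=
  fun u => coord c' (f (point c u)).

Record manifold (R : realType) (n : nat) := Manifold {
  carrier :> topologicalType;
  carrier_hausdorff : hausdorff_space carrier;
  carrier_second_countable : @second_countable carrier;
  atlas : set (chart R n carrier);
  atlas_cover : forall x, exists2 c, atlas c & dom c x;
  atlas_compatible : forall c c', atlas c -> atlas c' ->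
    smooth_on (local_dom id c c') (local_map id c c')
}.

Definition smooth_map (R : realType) (n n' : nat) (M : manifold R n)
    (N : manifold R n') (f : M -> N) : Prop :=
  continuous f /\
  forall c c', atlas c -> atlas c' ->
    smooth_on (local_dom f c c') (local_map f c c').

Definition immersion (R : realType) (n n' : nat) (M : manifold R n)
    (N : manifold R n') (f : M -> N) : Prop :=
  smooth_map f /\
  forall (p : M) c c', atlas c -> atlas c' -> dom c p -> dom c' (f p) ->
    row_free ('J (local_map f c c') (coord c p)).

Definition inner (R : realType) (n : nat) (G : 'M[R]_n) (v w : 'rV[R]_n) : R :=
  (v *m G *m w^T) 0 0.

(* Signature (n-1,1), in Sylvester normal form diag(1,...,1,-1). *)
Definition lorentzian (R : realType) (n : nat) (G : 'M[R]_n) : Prop :=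
  exists2 P : 'M[R]_n, P \in unitmx &
    P *m G *m P^T = diag_mx (\row_(i < n) if i.+1 == n then -1 else 1).

(* A twice covariant tensor field, given by its component matrix in each
   chart, as a function of the coordinates of that chart.                     *)
Record lorentz_metric (R : realType) (n : nat) (M : manifold R n) :=
  LorentzMetric {
  metric :> chart R n M -> 'rV[R]_n -> 'M[R]_n;
  metric_smooth : forall c, atlas c -> smooth_on (coord c @` dom c) (metric c);
  metric_sym : forall c x, atlas c -> dom c x ->
    (metric c (coord c x))^T = metric c (coord c x);
  metric_lorentzian : forall c x, atlas c -> dom c x ->
    lorentzian (metric c (coord c x));
  metric_transform : forall c c' x, atlas c -> atlas c' -> dom c x ->
    dom c' x ->
    metric c (coord c x) =
      'J (local_map id c c') (coord c x) *m metric c' (coord c' x)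
        *m ('J (local_map id c c') (coord c x))^T
}.

(* The hypersurface is an (m+1)-manifold V immersed by f in the (m+2)-manifold
   M (embedded hypersurfaces being the case where f is an inclusion).         *)
Definition lightlike_hypersurface (R : realType) (m : nat)
    (M : manifold R m.+2) (g : lorentz_metric M) (V : manifold R m.+1)
    (f : V -> M) : Prop :=
  immersion f /\
  forall (p : V) d c, atlas d -> atlas c -> dom d p -> dom c (f p) ->
    let T := 'J (local_map f d c) (coord d p) in
    \rank (T *m g c (coord c (f p)) *m T^T) = m.

(* Integral curves, up to parametrization, of the isotropic direction field of
   the hypersurface.                                                          *)
Definition isotropic_geodesic (R : realType) (m : nat) (M : manifold R m.+2)
    (g : lorentz_metric M) (V : manifold R m.+1) (f : V -> M)
    (I : set R) (l : R -> V) : Prop :=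
  [/\ open I, is_interval I,
      forall t, I t -> {for t, continuous l},
      forall d, atlas d ->
        smooth_on (I `&` l @^-1` dom d) (fun t => coord d (l t))
    & forall t d c, I t -> atlas d -> atlas c -> dom d (l t) ->
        dom c (f (l t)) ->
        let v := 'D_1 (fun t => coord d (l t)) t in
        let w := v *m 'J (local_map f d c) (coord d (l t)) in
        v != 0 /\ inner (g c (coord c (f (l t)))) w w = 0].

(* Christoffel symbol Gamma^k_ij of the Levi-Civita connection of G. *)
Definition christoffel (R : realType) (n : nat) (G : 'rV[R]_n -> 'M[R]_n)
    (x : 'rV[R]_n) (k i j : 'I_n) : R :=
  let dG (a b c : 'I_n) : R := ('D_(delta_mx 0 a) G x) b c in
  2^-1 * \sum_l invmx (G x) k l * (dG i j l + dG j i l - dG l i j).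

(* Covariant derivative D_w Y, in the direction of the vector w at u, of a
   vector field Y along the map F.                                            *)
Definition cov (R : realType) (p n : nat) (G : 'rV[R]_n -> 'M[R]_n)
    (F Y : 'rV[R]_p -> 'rV[R]_n) (w u : 'rV[R]_p) : 'rV[R]_n :=
  'D_w Y u +
  \row_k \sum_i \sum_j
    christoffel G (F u) k i j * (w *m 'J F u) 0 i * Y u 0 j.

(* A frame (e_1, ..., e_n), n = m+2, is the matrix of rows e_i; the indices are
   shifted by one: e_1 is row ord0, e_n is row ord_max, and the e_a,
   2 <= a <= n-1, are the rows scr a with a : 'I_m.                           *)
Definition scr (m : nat) (a : 'I_m) : 'I_m.+2 :=
  lift ord0 (widen_ord (leqnSn m) a).

Definition screen_gram (R : realType) (m : nat) (G E : 'M[R]_m.+2) : 'M[R]_m :=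
  \matrix_(a, b) inner G (row (scr a) E) (row (scr b) E).

(* The rows of T span the tangent space of the hypersurface. *)
Definition isotropic_frame (R : realType) (m : nat) (G : 'M[R]_m.+2)
    (T : 'M[R]_(m.+1, m.+2)) (E : 'M[R]_m.+2) : Prop :=
  let e i := row i E in
  [/\ E \in unitmx,
      ((\matrix_(i < m.+1) e (widen_ord (leqnSn m.+1) i)) == T)%MS,
      inner G (e ord0) (e ord0) = 0
        /\ (forall a, inner G (e ord0) (e (scr a)) = 0),
      (forall z : 'rV[R]_m, z != 0 -> 0 < inner (screen_gram G E) z z)
    & [/\ inner G (e ord_max) (e ord_max) = 0,
          inner G (e ord0) (e ord_max) = -1
        & forall a, inner G (e (scr a)) (e ord_max) = 0]].

(* E is a smooth field of first-order isotropic frames on a neighborhood of p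
   in V, expressed in the coordinates of d on V and of c on M.                *)
Definition isotropic_frame_field (R : realType) (m : nat) (M : manifold R m.+2)
    (g : lorentz_metric M) (V : manifold R m.+1) (f : V -> M)
    (d : chart R m.+1 V) (c : chart R m.+2 M) (p : V)
    (E : 'rV[R]_m.+1 -> 'M[R]_m.+2) : Prop :=
  exists W : set 'rV[R]_m.+1,
    [/\ open W, W (coord d p), W `<=` local_dom f d c, smooth_on W E
      & forall u, W u ->
          isotropic_frame (g c (local_map f d c u)) ('J (local_map f d c) u)
            (E u)].

(* The components omega_i^j of De_i = omega_i^j e_j on the vector w at u. *)
Definition conn_form (R : realType) (m : nat) (G : 'rV[R]_m.+2 -> 'M[R]_m.+2)
    (F : 'rV[R]_m.+1 -> 'rV[R]_m.+2) (E : 'rV[R]_m.+1 -> 'M[R]_m.+2)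
    (i j : 'I_m.+2) (w u : 'rV[R]_m.+1) : R :=
  (cov G F (fun u => row i (E u)) w u *m invmx (E u)) 0 j.

(* The coefficient lambda_ab of omega^b in omega_a^n = lambda_ab omega^b, that
   is omega_a^n(e_b), since omega^i(e_b) = delta^i_b.  The vector e_b, tangent
   to the hypersurface, is dF(w) for w = e_b *m pinvmx ('J F u).              *)
Definition second_fundamental (R : realType) (m : nat)
    (G : 'rV[R]_m.+2 -> 'M[R]_m.+2) (F : 'rV[R]_m.+1 -> 'rV[R]_m.+2)
    (E : 'rV[R]_m.+1 -> 'M[R]_m.+2) (u : 'rV[R]_m.+1) : 'M[R]_m :=
  \matrix_(a, b)
    conn_form G F E (scr a) ord_max (row (scr b) (E u) *m pinvmx ('J F u)) u.

(* lambda^a_b = g^ac lambda_cb *)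
Definition shape (R : realType) (m : nat) (M : manifold R m.+2)
    (g : lorentz_metric M) (V : manifold R m.+1) (f : V -> M)
    (d : chart R m.+1 V) (c : chart R m.+2 M)
    (E : 'rV[R]_m.+1 -> 'M[R]_m.+2) (p : V) : 'M[R]_m :=
  let F := local_map f d c in
  let u := coord d p in
  invmx (screen_gram (g c (F u)) (E u)) *m second_fundamental (g c) F E u.

(* A point of the projective line l is Some s for y = x + s e_1, and None for
   the point at infinity.  L is the matrix (lambda^a_b).                      *)
Definition singular_point (R : realType) (m : nat) (L : 'M[R]_m)
    (y : option R) : Prop :=
  if y is Some s then \det (1%:M + s *: L) = 0 else \det L = 0.

(* Multiplicity of the eigenvalue -1/s, respectively 0, of L.  The case s = 0
   is set apart because 0^-1 = 0; the point x itself is never singular.       *)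
Definition singular_mult (R : realType) (m : nat) (L : 'M[R]_m)
    (y : option R) : nat :=
  if y is Some s then
    if s == 0 then 0%N else mup (- s^-1) (char_poly L)
  else mup 0 (char_poly L).

(* There are exactly k real singular points, counted with multiplicity. *)
Definition carries_singular_points (R : realType) (m : nat) (L : 'M[R]_m)
    (k : nat) : Prop :=
  exists ys : seq (option R),
    [/\ size ys = k,
        forall y, y \in ys <-> singular_point L y
      & forall y, count_mem y ys = singular_mult L y].

(* Main.v *)
Require Import Defs.
From mathcomp Require Import complex.

Set Implicit Arguments.
Unset Strict Implicit.
Unset Printing Implicit Defensive.

(** The matrix lambda^a_b is g^ac lambda_cb, where g_ab is positive definite.
    Once lambda_ab is known to be symmetric, lambda^a_b is self-adjoint for the
    scalar product g_ab, so its characteristic polynomial splits over the reals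
    into n-2 linear factors.  The change of parameter x |-> -1/x, with 0 sent to
    the point at infinity, turns the roots into the singular points and keeps
    multiplicities.

    The symmetry of lambda_ab is where geometry enters.  Since e_1 is orthogonal
    to e_1 and to the e_a, and (e_1, e_n) = -1, the component on e_n of a vector
    X is -(X, e_1); hence lambda_ab = -(D_b e_a, e_1), where D_b is the
    covariant derivative along e_b (frame_last_coord).  Let F be the local
    expression of the immersion and w_a the vector of coordinate space with
    dF(w_a) = e_a at the point u considered.  The two fields e_a and
    x |-> dF_x(w_a) along F are both tangent to the hypersurface, thus
    orthogonal to e_1 at every point, and they agree at u.  Differentiating the
    two orthogonality relations along w_b and subtracting gives
      (d_b e_a, e_1) = (d_b d_a F, e_1) at u,
    where d_a is the flat derivative along the constant vector w_a.  This
    exchanges derivatives of the frame for second derivatives of F.  The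
    right-hand side is symmetric in a and b by Schwarz's theorem (schwarz), and
    the Christoffel term of D_b e_a is symmetric because the connection is
    torsion free (christoffelC).

    The spectral theorem for a real pencil (sym_char_poly_splits) is obtained
    over the complex numbers: an eigenvector a + i b of an eigenvalue x + i y
    yields real vectors a' and b', not both zero, such that
    y ((a',a') + (b',b')) = 0, so y = 0 by definiteness. *)

(** * Symmetric bilinear forms and real eigenvalues *)

Lemma innerC (R : realType) (n : nat) (G : 'M[R]_n) (v w : 'rV[R]_n) :
  G^T = G -> inner G v w = inner G w v.
Proof.
move=> symG; rewrite /inner -[in LHS](trmxK (v *m G *m w^T)) mxE.
by rewrite !trmx_mul trmxK symG mulmxA.
Qed.

Lemma posdef_unitmx (R : realType) (n : nat) (S : 'M[R]_n) :
  (forall z : 'rV[R]_n, z != 0 -> 0 < inner S z z) -> S \in unitmx.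
Proof.
move=> posS; rewrite unitmxE unitfE; apply/negP => /det0P [z z0 zS].
by have := posS z z0; rewrite /inner zS mul0mx mxE ltxx.
Qed.

Lemma inner_sumr (R : realType) (p n : nat) (G : 'M[R]_n) (c : 'rV[R]_p)
    (E : 'M[R]_(p, n)) (w : 'rV[R]_n) :
  inner G (c *m E) w = \sum_i c 0 i * inner G (row i E) w.
Proof.
rewrite /inner -2!mulmxA mxE; apply: eq_bigr => i _; congr (_ * _).
by rewrite -mulmxA -row_mul [RHS]mxE.
Qed.

Lemma innerDl (R : realType) (n : nat) (G : 'M[R]_n) (v v' w : 'rV[R]_n) :
  inner G (v + v') w = inner G v w + inner G v' w.
Proof. by rewrite /inner !mulmxDl mxE. Qed.

Local Open Scope complex_scope.

(** An eigenvector v = a + i b over the complex numbers for the eigenvalue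
    x + i y, read on its real and imaginary parts. *)
Lemma complex_eigenvector (R : rcfType) (n : nat) (L : 'M[R]_n) (z : R[i]) :
  root (map_poly (real_complex R) (char_poly L)) z ->
  exists a b : 'rV[R]_n, [/\ (a != 0) || (b != 0),
    a *m L = complex.Re z *: a - complex.Im z *: b
    & b *m L = complex.Im z *: a + complex.Re z *: b].
Proof.
rewrite map_char_poly -eigenvalue_root_char => /eigenvalueP [v vL v0].
exists (map_mx (@complex.Re R) v), (map_mx (@complex.Im R) v).
have coef j : \sum_k v 0 k * (L k j)%:C = z * v 0 j.
  move/matrixP: vL => /(_ 0 j); rewrite !mxE => <-.
  by apply: eq_bigr => k _; rewrite !mxE.
have ReE j : complex.Re (\sum_k v 0 k * (L k j)%:C)
    = \sum_k complex.Re (v 0 k) * L k j.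
  rewrite (big_morph _ (id1 := 0) (op1 := +%R) (fun x y => _)) //; last first.
    by case=> ? ? [].
  by apply: eq_bigr => k _; case: (v 0 k) => r s /=; rewrite mulr0 subr0.
have ImE j : complex.Im (\sum_k v 0 k * (L k j)%:C)
    = \sum_k complex.Im (v 0 k) * L k j.
  rewrite (big_morph _ (id1 := 0) (op1 := +%R) (fun x y => _)) //; last first.
    by case=> ? ? [].
  by apply: eq_bigr => k _; case: (v 0 k) => r s /=; rewrite mulr0 add0r.
split.
- apply: contraNT v0; rewrite negb_or !negbK => /andP[/eqP a0 /eqP b0].
  apply/eqP/rowP => j; move/rowP: a0 => /(_ j); move/rowP: b0 => /(_ j).
  by rewrite !mxE; case: (v 0 j) => r s /= -> ->.
- apply/rowP => j; rewrite !mxE.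
  under eq_bigr do rewrite mxE.
  by rewrite -ReE coef; case: z {vL coef} => x y; case: (v 0 j).
- apply/rowP => j; rewrite !mxE.
  under eq_bigr do rewrite mxE.
  rewrite -ImE coef; case: z {vL coef} => x y; case: (v 0 j) => r s /=.
  by rewrite addrC.
Qed.

(** Let a + i b be a complex eigenvector for the eigenvalue x + i y, and put
    a' = a S^-1 and b' = b S^-1, so that a' A = x a' S - y b' S and
    b' A = y a' S + x b' S.  Both relations compute the value of the symmetric
    form A at (a', b'); comparing them leaves y ((a',a') + (b',b')) = 0 for the
    scalar product S. *)
Lemma sym_char_poly_splits (R : realType) (n : nat) (S A : 'M[R]_n) :
  S^T = S -> A^T = A ->
  (forall z : 'rV[R]_n, z != 0 -> 0 < inner S z z) ->
  exists rs : seq R,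
    char_poly (invmx S *m A) = \prod_(x <- rs) ('X - x%:P).
Proof.
move=> symS symA posS; set L := invmx S *m A.
have uS : S \in unitmx by exact: posdef_unitmx.
have [zs pE] :=
  closed_field_poly_normal (map_poly (real_complex R) (char_poly L)).
rewrite lead_coef_map (monicP (char_poly_monic L)) rmorph1 scale1r in pE.
have realz z : z \in zs -> z = (complex.Re z)%:C.
  move=> zzs.
  have /complex_eigenvector[a [b [ab0 aL bL]]] :
      root (map_poly (real_complex R) (char_poly L)) z.
    by rewrite pE root_prod_XsubC.
  case: z {zzs} aL bL => x y /= aL bL; suff -> : y = 0 by [].
  pose a' := a *m invmx S; pose b' := b *m invmx S.
  have aE : a = a' *m S by rewrite mulmxKV.
  have bE : b = b' *m S by rewrite mulmxKV.
  have aA : a' *m A = x *: (a' *m S) - y *: (b' *m S).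
    by rewrite -aE -bE -aL /L mulmxA.
  have bA : b' *m A = y *: (a' *m S) + x *: (b' *m S).
    by rewrite -aE -bE -bL /L mulmxA.
  have : inner A a' b' = x * inner S a' b' - y * inner S b' b'.
    by rewrite /inner aA mulmxBl -!scalemxAl !mxE.
  have : inner A b' a' = y * inner S a' a' + x * inner S b' a'.
    by rewrite /inner bA mulmxDl -!scalemxAl !mxE.
  rewrite (innerC a' b' symA) (innerC b' a' symS) => -> abE.
  have /eqP : y * (inner S a' a' + inner S b' b') = 0.
    rewrite mulrDr; apply: (addIr (x * inner S a' b')).
    by rewrite add0r addrAC abE subrK.
  rewrite mulf_eq0 => /orP[/eqP//|/eqP nrm].
  have ge0 c : 0 <= inner S c c.
    have [->|/posS/ltW//] := eqVneq c 0.
    by rewrite /inner mul0mx mul0mx mxE.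
  case/orP: ab0 => [a0|b0].
  - have /posS : a' != 0 by apply: contraNneq a0 => a'0; rewrite aE a'0 mul0mx.
    by move=> h; have := ltr_pwDl h (ge0 b'); rewrite nrm ltxx.
  - have /posS : b' != 0 by apply: contraNneq b0 => b'0; rewrite bE b'0 mul0mx.
    by move=> h; have := ltr_pwDl h (ge0 a'); rewrite addrC nrm ltxx.
exists [seq complex.Re z | z <- zs].
apply: (map_poly_inj (real_complex R)).
rewrite pE big_map rmorph_prod; apply: eq_big_seq => z /realz zE.
by rewrite rmorphB /= map_polyX map_polyC /= -zE.
Qed.

Local Close Scope complex_scope.

(** * From eigenvalues to singular points *)

Lemma mup_prod_XsubC (F : fieldType) (rs : seq F) (x : F) :
  mup x (\prod_(r <- rs) ('X - r%:P)) = count_mem x rs.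
Proof.
elim: rs => [|r rs IH]; first by rewrite big_nil mupNroot // root1.
rewrite big_cons mupM ?polyXsubC_eq0 ?monic_neq0 ?monic_prod_XsubC //.
by rewrite IH -['X - r%:P]expr1 mup_XsubCX /= eq_sym; case: (r == x).
Qed.

(** For s != 0, 1 + s L = -s (-1/s - L), so the finite singular point s
    corresponds to the eigenvalue -1/s; the eigenvalue 0 corresponds to the
    point at infinity.  The point s = 0 corresponds to no eigenvalue and is
    never singular. *)
Lemma splits_carries_singular_points (R : realType) (n : nat) (L : 'M[R]_n)
    (rs : seq R) :
  char_poly L = \prod_(x <- rs) ('X - x%:P) -> carries_singular_points L n.
Proof.
move=> pE.
pose pt (x : R) : option R := if x == 0 then None else Some (- x^-1).
have pt_inj : injective pt.
  move=> x y; rewrite /pt.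
  have [->|x0] := eqVneq x 0; have [->|y0] := eqVneq y 0 => //.
  by case=> /oppr_inj/invr_inj.
have szrs : size rs = n.
  by have := size_char_poly L; rewrite pE size_prod_XsubC => -[].
have mem_rs x : (x \in rs) = (\det (x%:M - L) == 0).
  rewrite -root_prod_XsubC -pE rootE /char_poly -horner_evalE -det_map_mx.
  congr (\det _ == 0); apply/matrixP => i j; rewrite !mxE.
  by rewrite /= /horner_eval hornerD hornerN hornerC hornerMn hornerX.
have det0E : (0 \in rs) = (\det L == 0).
  by rewrite mem_rs raddf0 sub0r -scaleN1r detZ mulf_eq0 signr_eq0.
have detsE s : s != 0 -> (- s^-1 \in rs) = (\det (1%:M + s *: L) == 0).
  move=> s0; rewrite mem_rs.
  have -> : 1%:M + s *: L = (- s) *: ((- s^-1)%:M - L).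
    by rewrite scalerBr scale_scalar_mx mulrNN divff // scaleNr opprK.
  by rewrite detZ mulf_eq0 expf_eq0 oppr_eq0 (negPf s0) andbF.
have SomeE s : s != 0 -> Some s = pt (- s^-1).
  by move=> s0; rewrite /pt oppr_eq0 invr_eq0 (negPf s0) invrN opprK invrK.
have NoneE : None = pt 0 by rewrite /pt eqxx.
have pt0 x : pt x != Some 0.
  rewrite /pt; have [//|x0] := eqVneq x 0.
  by apply/eqP => -[] /eqP; rewrite oppr_eq0 invr_eq0; apply/negP.
have pt_nmem : Some 0 \notin map pt rs.
  by apply/mapP => -[x _ xE]; have := pt0 x; rewrite -xE eqxx.
exists (map pt rs); split; first by rewrite size_map.
- case=> [s|] /=; last by rewrite NoneE mem_map // det0E; split=> /eqP.
  have [->|s0] := eqVneq s 0.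
    rewrite (negPf pt_nmem) scale0r addr0 det1; split=> // /eqP.
    by rewrite oner_eq0.
  by rewrite SomeE // mem_map // detsE //; split=> /eqP.
- case=> [s|] /=; last first.
    rewrite NoneE count_map pE mup_prod_XsubC.
    by apply: eq_count => x; rewrite /= (inj_eq pt_inj).
  have [->|s0] := eqVneq s 0; first exact/count_memPn.
  rewrite SomeE // count_map pE mup_prod_XsubC.
  by apply: eq_count => x; rewrite /= (inj_eq pt_inj).
Qed.

(** * Directional derivatives: Schwarz's theorem and product rules *)

(** Restriction of a derivative to the line x + t v, which reduces questions
    about directional derivatives to functions of one real variable. *)
Lemma is_derive_line (R : realType) (V W : normedModType R) (f : V -> W)
    (x v : V) (s : R) (df : W) :
  is_derive (x + s *: v) v f df ->
  is_derive s 1 (fun t : R => f (x + t *: v)) df.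
Proof.
pose g (t : R) := f (x + t *: v).
have E : (fun h : R => h^-1 *: ((g \o shift s) (h *: 1) - g s))
  = (fun h => h^-1 *: ((f \o shift (x + s *: v)) (h *: v) - f (x + s *: v))).
  apply/funext => h; rewrite /g /=; congr (_ *: (f _ - _)).
  by rewrite [h *: 1]mulr1 scalerDl addrCA.
by move=> [fd fE]; split; rewrite -/g /derivable /derive E.
Qed.

Definition second_quotient (R : realType) (V : normedModType R) (f : V -> R)
    (u v w : V) (h : R) : R :=
  (f (u + h *: v + h *: w) - f (u + h *: v) - f (u + h *: w) + f u) / h ^+ 2.

Lemma second_quotientC (R : realType) (V : normedModType R) (f : V -> R)
    (u v w : V) : second_quotient f u v w = second_quotient f u w v.
Proof.
apply/funext => h; rewrite /second_quotient.
by rewrite (addrAC u (h *: w)) (addrAC (f _) (- f (u + h *: w))).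
Qed.

(** The mean value theorem, applied first along v and then along w, writes the
    second difference as h^2 times the value of the second derivative at some
    point of the parallelogram with sides h v and h w; continuity at u
    concludes. *)
Lemma second_difference_cvg (R : realType) (V : normedModType R) (A : set V)
    (f fv fvw : V -> R) (v w u : V) : open A -> A u ->
  (forall x, A x -> is_derive x v f (fv x)) ->
  (forall x, A x -> is_derive x w fv (fvw x)) ->
  {for u, continuous fvw} ->
  second_quotient f u v w @ 0^'+ --> fvw u.
Proof.
move=> Ao Au dv dw cf.
apply/cvgrPdist_lt => e e0.
have : \forall x \near u, A x /\ `|fvw u - fvw x| < e.
  near=> x; split; near: x; first exact: open_nbhs_nbhs.
  by move/cvgrPdist_lt : cf; apply.
move=> /nbhs_ballP[r r0 hr].
near=> h.
have h0 : 0 < h by near: h; exact: nbhs_right_gt.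
have hvw : h * (`|v| + `|w| + 1) < r.
  rewrite -ltr_pdivlMr; last by rewrite ltr_wpDl // addr_ge0.
  near: h; apply: nbhs_right_lt; rewrite divr_gt0 // ltr_wpDl // addr_ge0 //.
have inball s t : 0 <= s -> s <= h -> 0 <= t -> t <= h ->
    A (u + s *: v + t *: w) /\ `|fvw u - fvw (u + s *: v + t *: w)| < e.
  move=> s0 sh t0 th; apply: hr; rewrite -ball_normE /=.
  rewrite -addrA opprD addrA subrr sub0r normrN.
  apply: le_lt_trans hvw; apply: (le_trans (ler_normD _ _)).
  rewrite !normrZ (ger0_norm s0) (ger0_norm t0) mulrDr mulrDr mulr1.
  rewrite -[leLHS]addr0 lerD // ?(ltW h0) //.
  by rewrite lerD // ler_wpM2r.
pose phi (s : R) := f (u + h *: w + s *: v) - f (u + s *: v).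
pose dphi (s : R) := fv (u + h *: w + s *: v) - fv (u + s *: v).
have dphiP s : 0 <= s <= h -> is_derive s 1 phi (dphi s).
  move=> /andP[s0 sh]; apply: is_deriveB; apply: is_derive_line; apply: dv.
    by rewrite addrAC; apply: (inball _ _ _ _ _ _).1 => //; exact: ltW.
  by have [] := inball s 0 s0 sh (lexx 0) (ltW h0); rewrite scale0r addr0.
have [s] : exists2 s, s \in `]0, h[%R & phi h - phi 0 = dphi s * (h - 0).
  apply: MVT => //.
    by move=> s; rewrite in_itv /= => /andP[s0 sh]; apply: dphiP; rewrite !ltW.
  apply: derivable_within_continuous => s; rewrite in_itv /= => sh.
  by have [] := dphiP s sh.
rewrite in_itv /= => /andP[/ltW s0 /ltW sh] phiE.
pose psi (t : R) := fv (u + s *: v + t *: w).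
have dpsiP t : 0 <= t <= h -> is_derive t 1 psi (fvw (u + s *: v + t *: w)).
  move=> /andP[t0 th]; apply: is_derive_line; apply: dw.
  exact: (inball _ _ _ _ _ _).1.
have [t] : exists2 t, t \in `]0, h[%R &
    psi h - psi 0 = fvw (u + s *: v + t *: w) * (h - 0).
  apply: (@MVT _ psi (fun t => fvw (u + s *: v + t *: w))) => //.
    by move=> t; rewrite in_itv /= => /andP[t0 th]; apply: dpsiP; rewrite !ltW.
  apply: derivable_within_continuous => t; rewrite in_itv /= => th.
  by have [] := dpsiP t th.
rewrite in_itv /= => /andP[/ltW t0 /ltW th] psiE.
rewrite /second_quotient.
have -> : f (u + h *: v + h *: w) - f (u + h *: v) - f (u + h *: w) + f u
    = fvw (u + s *: v + t *: w) * h ^+ 2.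
  transitivity (phi h - phi 0).
    rewrite /phi scale0r !addr0 (addrAC u (h *: v)) opprB !addrA.
    by rewrite [RHS]addrAC.
  rewrite phiE subr0 expr2 mulrA; congr (_ * h).
  by rewrite -[h in RHS]subr0 -psiE /psi /dphi scale0r addr0 addrAC.
by rewrite mulfK ?expf_neq0 ?gt_eqF //; exact: (inball _ _ _ _ _ _).2.
Unshelve. all: by end_near.
Qed.

(** The second difference does not depend on the order of v and w, and its
    quotient by h^2 has both mixed derivatives as limit. *)
Lemma mixed_derive_eq (R : realType) (V : normedModType R) (A : set V)
    (f fv fw fvw fwv : V -> R) (v w u : V) : open A -> A u ->
  (forall x, A x -> is_derive x v f (fv x)) ->
  (forall x, A x -> is_derive x w f (fw x)) ->
  (forall x, A x -> is_derive x w fv (fvw x)) ->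
  (forall x, A x -> is_derive x v fw (fwv x)) ->
  {for u, continuous fvw} -> {for u, continuous fwv} ->
  fvw u = fwv u.
Proof.
move=> Ao Au dv dw dvw dwv cvw cwv.
have h1 := second_difference_cvg Ao Au dv dvw cvw.
have h2 := second_difference_cvg Ao Au dw dwv cwv.
rewrite second_quotientC in h2.
exact: (cvg_unique _ h1 h2).
Qed.

Lemma is_derive_coord (R : realType) (V : normedModType R) (m n : nat)
    (F : V -> 'M[R]_(m, n)) (x v : V) i j :
  derivable F x v -> is_derive x v (fun y => F y i j) ('D_v F x i j).
Proof.
move=> dF; rewrite derive_mx // mxE; apply: derivableP.
by move/derivable_mxP : dF; apply.
Qed.

Lemma schwarz (R : realType) (V : normedModType R) (m n : nat) (A : set V)
    (F : V -> 'M[R]_(m, n)) (v w u : V) : open A -> A u -> Ck 2 A F ->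
  'D_v ('D_w F) u = 'D_w ('D_v F) u.
Proof.
move=> Ao Au [dF /= d2F].
apply/matrixP => i j.
have d1 z x : A x -> is_derive x z (fun y => F y i j) ('D_z F x i j).
  by move=> Ax; apply: is_derive_coord; apply: diff_derivable; exact: dF.
have d2 z z' x : A x ->
    is_derive x z (fun y => 'D_z' F y i j) ('D_z ('D_z' F) x i j).
  move=> Ax; apply: is_derive_coord; apply: diff_derivable.
  exact: (d2F z').1.
have c2 z z' : {for u, continuous (fun x => 'D_z ('D_z' F) x i j)}.
  have := (d2F z').2 z u Au => h.
  apply: (@continuous_comp _ _ _ ('D_z ('D_z' F))
    (fun N : 'M[R]_(m, n) => N i j)) => //.
  exact: (differentiable_continuous (differentiable_coord _ i j)).
exact: (mixed_derive_eq Ao Au (d1 w) (d1 v) (d2 v w) (d2 w v)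
  (c2 v w) (c2 w v)).
Qed.

Lemma derive_mulmx (R : realType) (V : normedModType R) (m n p : nat)
    (A : V -> 'M[R]_(m, n)) (B : V -> 'M[R]_(n, p)) (x v : V) :
  derivable A x v -> derivable B x v ->
  is_derive x v (fun y => A y *m B y) ('D_v A x *m B x + A x *m 'D_v B x).
Proof.
move=> dA dB.
have d i j : is_derive x v (fun y => (A y *m B y) i j)
    (('D_v A x *m B x + A x *m 'D_v B x) i j).
  have -> : (fun y => (A y *m B y) i j) = \sum_k (fun y => A y i k * B y k j).
    by apply/funext => y; rewrite mxE fct_sumE.
  rewrite !mxE -big_split /=; apply: is_derive_sum => k.
  apply: (is_derive_eq
    (is_deriveM (is_derive_coord i k dA) (is_derive_coord k j dB))).
  by rewrite addrC /GRing.scale /= [X in _ + X = _]mulrC.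
have dAB : derivable (fun y => A y *m B y) x v.
  by apply/derivable_mxP => i j; have [] := d i j.
split=> //; rewrite derive_mx //; apply/matrixP => i j.
by rewrite mxE; have [] := d i j.
Qed.

Lemma derive_trmx (R : realType) (V : normedModType R) (m n : nat)
    (A : V -> 'M[R]_(m, n)) (x v : V) :
  derivable A x v -> is_derive x v (fun y => (A y)^T) ('D_v A x)^T.
Proof.
move=> dA.
have d i j : is_derive x v (fun y => (A y)^T i j) (('D_v A x)^T i j).
  rewrite mxE; have := is_derive_coord j i dA.
  by congr (is_derive _ _ _ _); apply/funext => y; rewrite mxE.
have dAT : derivable (fun y => (A y)^T) x v.
  by apply/derivable_mxP => i j; have [] := d i j.
split=> //; rewrite derive_mx //; apply/matrixP => i j.
by rewrite mxE; have [] := d i j.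
Qed.

Lemma is_derive_inner (R : realType) (V : normedModType R) (n : nat)
    (G : V -> 'M[R]_n) (X Y : V -> 'rV[R]_n) (x v : V) :
  derivable G x v -> derivable X x v -> derivable Y x v ->
  is_derive x v (fun y => inner (G y) (X y) (Y y))
    (inner ('D_v G x) (X x) (Y x) + inner (G x) ('D_v X x) (Y x)
       + inner (G x) (X x) ('D_v Y x)).
Proof.
move=> dG dX dY.
have [dXG XGE] := derive_mulmx dX dG.
have [dYT YTE] := derive_trmx dY.
have [d dE] := derive_mulmx dXG dYT.
have := is_derive_coord 0 0 d.
rewrite dE XGE YTE /inner => h; apply: (is_derive_eq h).
by rewrite mulmxDl !mxE [X in _ = X + _]addrC.
Qed.

Lemma is_derive_near0 (R : realType) (V : normedModType R) (f : V -> R)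
    (x v : V) (df : R) :
  is_derive x v f df -> (\forall y \near x, f y = 0) -> df = 0.
Proof.
move=> dfx f0; have [_ <-] := near_eq_is_derive f0 dfx.
exact: derive_cst.
Qed.

(** * First-order isotropic frames *)

Variant frame_index_spec (m : nat) : 'I_m.+2 -> Prop :=
  | FrameFirst : frame_index_spec ord0
  | FrameScreen (a : 'I_m) : frame_index_spec (scr a)
  | FrameLast : frame_index_spec ord_max.

Lemma frame_indexP (m : nat) (i : 'I_m.+2) : frame_index_spec i.
Proof.
case: (unliftP ord0 i) => [j|] ->; last exact: FrameFirst.
case: (ltnP j m) => [jm|mj].
  have -> : lift ord0 j = scr (Ordinal jm) by apply: val_inj.
  exact: FrameScreen.
have -> : lift ord0 j = ord_max.
  apply: val_inj => /=; rewrite /bump leq0n add1n; congr _.+1.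
  by apply/eqP; rewrite eqn_leq mj andbT -ltnS ltn_ord.
exact: FrameLast.
Qed.

Section Frame.
Variables (R : realType) (m : nat) (G E : 'M[R]_m.+2) (T : 'M[R]_(m.+1, m.+2)).
Hypotheses (symG : G^T = G) (frameE : isotropic_frame G T E).

(** All the vectors of the frame are orthogonal to e_1, except e_n, for which
    (e_1, e_n) = -1. *)
Lemma frame_last_coord (X : 'rV[R]_m.+2) :
  (X *m invmx E) 0 ord_max = - inner G X (row ord0 E).
Proof.
case: frameE => uE _ [e00 e0a] _ [_ e0n _].
rewrite -{2}(mulmxKV uE X) inner_sumr (bigD1 ord_max) //= big1 ?addr0.
  by rewrite (innerC _ _ symG) e0n mulrN1 opprK.
move=> i; case: (frame_indexP i) => [|a|]; last by rewrite eqxx.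
  by rewrite e00 mulr0.
by rewrite (innerC _ _ symG) e0a mulr0.
Qed.

Lemma tangent_orthogonal (X : 'rV[R]_m.+2) :
  (X <= T)%MS -> inner G X (row ord0 E) = 0.
Proof.
case: frameE => _ /eqmxP spanT [e00 e0a] _ _.
rewrite -spanT => /submxP[c ->]; rewrite inner_sumr big1 // => i _.
rewrite rowK; case: (unliftP ord0 i) => [j|] ->.
  have -> : widen_ord (leqnSn m.+1) (lift ord0 j) = scr j by apply: val_inj.
  by rewrite (innerC _ _ symG) e0a mulr0.
by rewrite (_ : widen_ord _ _ = ord0) ?e00 ?mulr0 //; apply: val_inj.
Qed.

Lemma frame_tangent (i : 'I_m.+2) : i != ord_max -> (row i E <= T)%MS.
Proof.
case: frameE => _ /eqmxP spanT _ _ _ i_max; rewrite -spanT.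
have im : (i < m.+1)%N.
  rewrite ltn_neqAle -ltnS ltn_ord andbT; apply: contraNneq i_max => im.
  exact/eqP/val_inj.
apply/submxP; exists (delta_mx 0 (Ordinal im)); rewrite -rowE rowK.
by congr (row _ E); apply: val_inj.
Qed.

Lemma screen_gram_sym : (screen_gram G E)^T = screen_gram G E.
Proof. by apply/matrixP => a b; rewrite !mxE innerC. Qed.

End Frame.

Lemma scr_neq_max (m : nat) (a : 'I_m) : scr a != ord_max.
Proof. by rewrite -val_eqE /= /bump leq0n add1n eqSS ltn_eqF. Qed.

(** * The second fundamental tensor *)

(** The Levi-Civita connection is torsion free.  The last derivative in the
    Christoffel symbol is symmetric in i and j only because G is symmetric in a
    whole neighborhood of x. *)
Lemma christoffelC (R : realType) (n : nat) (G : 'rV[R]_n -> 'M[R]_n)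
    (x : 'rV[R]_n) (k i j : 'I_n) :
  differentiable G x -> (\forall y \near x, (G y)^T = G y) ->
  christoffel G x k i j = christoffel G x k j i.
Proof.
move=> dG symG.
have symdG v : ('D_v G x)^T = 'D_v G x.
  have [_ <-] := derive_trmx (diff_derivable (v := v) dG).
  exact: near_eq_derive.
rewrite /christoffel; congr (_ * _); apply: eq_bigr => l _; congr (_ * _).
by congr (_ - _); [rewrite addrC | rewrite -[in LHS]symdG mxE].
Qed.

(** Near u, the fields 'D_(w a) F are tangent to the hypersurface, and at u they
    agree with the frame.  Replacing e_a by 'D_(w a) F thus leaves the scalar
    product of the derivative with e_1 unchanged, and expresses lambda_ab by
    second derivatives of F and Christoffel symbols, both symmetric. *)
Lemma second_fundamental_sym (R : realType) (m : nat)
    (G : 'rV[R]_m.+2 -> 'M[R]_m.+2) (F : 'rV[R]_m.+1 -> 'rV[R]_m.+2)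
    (E : 'rV[R]_m.+1 -> 'M[R]_m.+2) (W : set 'rV[R]_m.+1) (u : 'rV[R]_m.+1) :
  open W -> W u -> smooth_on W F -> smooth_on W E ->
  differentiable G (F u) -> (\forall y \near F u, (G y)^T = G y) ->
  (forall x, W x -> isotropic_frame (G (F x)) ('J F x) (E x)) ->
  (second_fundamental G F E u)^T = second_fundamental G F E u.
Proof.
move=> Wo Wu sF sE dG symG frameE.
have dF x : W x -> differentiable F x by exact: (sF 1%N).1.
have dE x : W x -> differentiable E x by exact: (sE 1%N).1.
have nW : \forall x \near u, W x by exact: open_nbhs_nbhs.
have nsymG : \forall x \near u, (G (F x))^T = G (F x).
  have cF : F x @[x --> u] --> F u.
    exact: differentiable_continuous (dF _ Wu).
  exact: (cF _ symG).
have symGu : (G (F u))^T = G (F u) := nbhs_singleton symG.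
pose e i (x : 'rV[R]_m.+1) := row i (E x).
pose w a : 'rV[R]_m.+1 := row (scr a) (E u) *m pinvmx ('J F u).
have wJ a : w a *m 'J F u = e (scr a) u.
  by rewrite mulmxKpV // (frame_tangent (frameE _ Wu)) // scr_neq_max.
have derivGF v : derivable (fun x => G (F x)) u v.
  by apply: diff_derivable; apply: differentiable_comp => //; exact: dF.
have deriv_e i v : derivable (e i) u v.
  apply/derivable_mxP => i' j.
  have -> : (fun x => e i x i' j) = (fun x => E x i j).
    by apply/funext => x; rewrite mxE.
  by have [] := is_derive_coord i j (diff_derivable (v := v) (dE _ Wu)).
have derivDF v v' : derivable ('D_v' F) u v.
  by apply: diff_derivable; exact: ((sF 2%N).2 v').1.
pose S a b := inner (G (F u)) ('D_(w b) ('D_(w a) F) u) (e ord0 u).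
have e0De a b : inner (G (F u)) ('D_(w b) (e (scr a)) u) (e ord0 u) = S a b.
  (* Both fields are orthogonal to e_1 near u and have the same value at u, so
     the derivatives of the two orthogonality relations differ only in the
     term compared here. *)
  have D1 := is_derive_inner (derivGF (w b)) (deriv_e (scr a) (w b))
    (deriv_e ord0 (w b)).
  have D2 := is_derive_inner (derivGF (w b)) (derivDF (w b) (w a))
    (deriv_e ord0 (w b)).
  have {}D1 := is_derive_near0 D1; have {}D2 := is_derive_near0 D2.
  have /D1 {}D1 : \forall x \near u,
      inner (G (F x)) (e (scr a) x) (e ord0 x) = 0.
    near=> x; have Wx : W x by near: x.
    apply: (tangent_orthogonal _ (frameE _ Wx)); first by near: x.
    by apply: (frame_tangent (frameE _ Wx)); exact: scr_neq_max.
  have /D2 {}D2 : \forall x \near u,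
      inner (G (F x)) ('D_(w a) F x) (e ord0 x) = 0.
    near=> x; have Wx : W x by near: x.
    apply: (tangent_orthogonal _ (frameE _ Wx)); first by near: x.
    by rewrite deriveEjacobian ?submxMl //; exact: dF.
  have DwF : 'D_(w a) F u = e (scr a) u.
    by rewrite deriveEjacobian ?wJ //; exact: dF.
  by move: D2; rewrite DwF -D1 => /addIr/addrI.
have SC a b : S a b = S b a by rewrite /S (schwarz _ _ Wo Wu (sF 2%N)).
pose Gam a b : 'rV[R]_m.+2 := \row_k \sum_i \sum_j
  christoffel G (F u) k i j * e (scr b) u 0 i * e (scr a) u 0 j.
have GamC a b : Gam a b = Gam b a.
  apply/rowP => k; rewrite !mxE exchange_big /=; apply: eq_bigr => i _.
  apply: eq_bigr => j _; rewrite (christoffelC _ _ _ dG symG).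
  by rewrite mulrAC.
have lamE a b : second_fundamental G F E u a b =
    - (S a b + inner (G (F u)) (Gam a b) (e ord0 u)).
  rewrite mxE /conn_form (frame_last_coord symGu (frameE _ Wu)).
  by rewrite /cov innerDl wJ; rewrite e0De.
by apply/matrixP => a b; rewrite mxE !lamE SC GamC.
Unshelve. all: by end_near.
Qed.

Lemma Ck_subset (R : realType) (U W : normedModType R) (k : nat) (A B : set U)
    (f : U -> W) : A `<=` B -> Ck k B f -> Ck k A f.
Proof.
move=> AB; elim: k f => [|k IH] f /=; first by move=> cf x /AB; exact: cf.
move=> [df dvf]; split=> [x /AB|v]; first exact: df.
exact/IH/dvf.
Qed.

Theorem theorem3 (R : realType) (m : nat)
    (M : manifold R m.+2) (g : lorentz_metric M)
    (V : manifold R m.+1) (f : V -> M) (hV : lightlike_hypersurface g f)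
    (I : set R) (l : R -> V) (hl : isotropic_geodesic g f I l)
    (t : R) (It : I t)
    (d : chart R m.+1 V) (c : chart R m.+2 M) (hd : atlas d) (hc : atlas c)
    (dt : dom d (l t)) (ct : dom c (f (l t)))
    (E : 'rV[R]_m.+1 -> 'M[R]_m.+2)
    (hE : isotropic_frame_field g f d c (l t) E) :
  carries_singular_points (shape g f d c E (l t)) (m.+2 - 2).
Proof.
case: hE => W [Wo Wu Wdom sE frameE].
have sF : smooth_on W (local_map f d c).
  by move=> k; apply: (Ck_subset Wdom); apply: hV.1.1.2.
have Fu : (coord c @` dom c) (local_map f d c (coord d (l t))).
  by rewrite /local_map coordK //; exists (f (l t)).
have symG x : (coord c @` dom c) x -> (g c x)^T = g c x.
  by move=> [q cq <-]; exact: metric_sym.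
have nsymG : \forall x \near local_map f d c (coord d (l t)), (g c x)^T = g c x.
  apply: filterS symG _; apply: open_nbhs_nbhs; split=> //; exact: img_open.
have dG : differentiable (g c) (local_map f d c (coord d (l t))).
  by apply: (metric_smooth g hc 1%N).1.
have frame_lt := frameE _ Wu.
have [_ _ _ posS _] := frame_lt.
have [rs split_rs] := sym_char_poly_splits
  (screen_gram_sym (E (coord d (l t))) (symG _ Fu))
  (second_fundamental_sym Wo Wu sF sE dG nsymG frameE) posS.
by rewrite subn2; apply: splits_carries_singular_points split_rs.
Qed.
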